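(* For $A\in\mathcal{PM}(n)$, $B\in\mathcal{PM}(m)$ and $i\in[n]$ let $\mathrm{Max}_i(A,B)$ be the $m\times(i-1)$ matrix whose $j$-th row equals $A_{(i)}$ if $j$ is a maximal element of the poset associated to $B$, and is the zero row otherwise, and define $$A\circ^{\max}_i B=\begin{pmatrix}A_{11}&\mathbb{O}&\mathbb{O}\\ \mathrm{Max}_i(A,B)&B&\mathbb{O}\\ A_{21}&\mathbb{1}_m\otimes A^{(i)}&A_{22}\end{pmatrix}.$$ Then the maps $\circ^{\max}_i$ endow $\mathcal{PM}=\bigsqcup_{n\ge1}\mathcal{PM}(n)$ with a set operad structure, that is: (a) $A\circ^{\max}_i B\in\mathcal{PM}(n+m-1)$ for all $A\in\mathcal{PM}(n)$, $B\in\mathcal{PM}(m)$, $i\in[n]$; (b) for all $A\in\mathcal{PM}(n)$, $B\in\mathcal{PM}(m)$, $C\in\mathcal{PM}(k)$, $i\in[n]$, $j\in[m]$: $(A\circ^{\max}_i B)\circ^{\max}_{i+j-1}C=A\circ^{\max}_i(B\circ^{\max}_j C)$; (c) for all $A\in\mathcal{PM}(n)$, $B\in\mathcal{PM}(m)$, $C\in\mathcal{PM}(k)$ and $1\le i<j\le n$: $(A\circ^{\max}_i B)\circ^{\max}_{j+m-1}C=(A\circ^{\max}_j C)\circ^{\max}_i B$; (d) $[1]\circ^{\max}_1 A=A\circ^{\max}_i[1]=A$ for all $A\in\mathcal{PM}(n)$, $i\in[n]$.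
   Context: A poset matrix of order $n$ is an $n\times n$ $(0,1)$-matrix $A=[a_{st}]$ that is lower triangular with all diagonal entries $1$ and transitive ($a_{st}=a_{tu}=1\Rightarrow a_{su}=1$); $\mathcal{PM}(n)$ is the set of these. The poset associated to $B=[b_{st}]\in\mathcal{PM}(m)$ is $[m]$ with $t\le s$ iff $b_{st}=1$; so $j$ is maximal iff column $j$ of $B$ has no $1$ below the diagonal. $A[\alpha\mid\beta]$ is the submatrix with rows $\alpha$ and columns $\beta$, $A[\alpha]=A[\alpha\mid\alpha]$. For $A\in\mathcal{PM}(n)$, $i\in[n]$: $A_{11}=A[\{1,\dots,i-1\}]$, $A_{22}=A[\{i+1,\dots,n\}]$, $A_{21}=A[\{i+1,\dots,n\}\mid\{1,\dots,i-1\}]$, $A_{(i)}=A[\{i\}\mid\{1,\dots,i-1\}]$, $A^{(i)}=A[\{i+1,\dots,n\}\mid\{i\}]$; empty blocks are vacuous. $\mathbb{1}_m\otimes A^{(i)}$ is the $(n-i)\times m$ matrix all of whose columns equal $A^{(i)}$. *)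

(* Defs.v *)
From mathcomp Require Import all_boot all_order all_algebra.

Set Implicit Arguments.
Unset Strict Implicit.
Unset Printing Implicit Defensive.

(* (0,1)-matrices are matrices over bool, with 1 = true and 0 = false.
   Indices are 0-based: the ordinal i : 'I_n stands for i + 1 in [n]. *)

Definition is_poset_matrix n (A : 'M[bool]_n) : Prop :=
  [/\ forall s t : 'I_n, s < t -> A s t = false,
      forall s, A s s = true
    & forall s t u, A s t = true -> A t u = true -> A s u = true].

Definition poset_le m (B : 'M[bool]_m) : rel 'I_m := fun t s => B s t.

Definition poset_maximal m (B : 'M[bool]_m) (j : 'I_m) : bool :=
  [forall s, poset_le B j s ==> (s == j)].

Section Blocks.

Variables (n : nat) (i : 'I_n).

Definition ord_before (s : 'I_i) : 'I_n := widen_ord (ltnW (ltn_ord i)) s.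

(* the s-th index strictly after i, that is, i + 1 + s *)
Definition ord_after (s : 'I_(n - i.+1)) : 'I_n :=
  cast_ord (subnKC (ltn_ord i)) (rshift i.+1 s).

Variable A : 'M[bool]_n.

Definition blk11 : 'M[bool]_i := mxsub ord_before ord_before A.
Definition blk22 : 'M[bool]_(n - i.+1) := mxsub ord_after ord_after A.
Definition blk21 : 'M[bool]_(n - i.+1, i) := mxsub ord_after ord_before A.
Definition blk_row : 'rV[bool]_i := mxsub (fun=> i) ord_before A.
Definition blk_col : 'cV[bool]_(n - i.+1) := mxsub ord_after (fun=> i) A.

Definition max_blk m (B : 'M[bool]_m) : 'M[bool]_(m, i) :=
  \matrix_(j < m) (if poset_maximal B j then blk_row else const_mx false).

Definition rep_col m : 'M[bool]_(n - i.+1, m) := \matrix_(s, t) blk_col s ord0.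

End Blocks.

Fact max_comp_size n m (i : 'I_n) : i + m + (n - i.+1) = n + m - 1.
Proof.
by rewrite -[in RHS](subnKC (ltn_ord i)) addnAC addSn addSn subn1.
Qed.

Definition max_comp n m (A : 'M[bool]_n) (i : 'I_n) (B : 'M[bool]_m) :
    'M[bool]_(n + m - 1) :=
  castmx (max_comp_size m i, max_comp_size m i)
    (block_mx
       (block_mx (blk11 i A)     (const_mx false)
                 (max_blk i A B) B              ) (const_mx false)
       (row_mx   (blk21 i A)     (rep_col i A m)) (blk22 i A)).

Definition unit_pm : 'M[bool]_1 := const_mx true.

(* Positions in a composite. In 1-based terms, ord_nested i j is i + j - 1;
   for i < j, ord_right m is j + m - 1 and ord_left k is i. *)

Fact ord_nested_subproof n m (i : 'I_n) (j : 'I_m) : i + j < n + m - 1.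
Proof.
by case: n i => [[]//|n] i; rewrite addSn subn1 /= -addnS leq_add // -ltnS.
Qed.

Definition ord_nested n m (i : 'I_n) (j : 'I_m) : 'I_(n + m - 1) :=
  Ordinal (ord_nested_subproof i j).

Fact ord_right_subproof n m (i j : 'I_n) : i < j -> j + m - 1 < n + m - 1.
Proof.
by move=> ij; rewrite ltn_sub2r ?ltn_add2r// ltn_addr// (leq_ltn_trans _ (leq_ltn_trans ij (ltn_ord j))).
Qed.

Definition ord_right n m (i j : 'I_n) (ij : i < j) : 'I_(n + m - 1) :=
  Ordinal (ord_right_subproof m ij).

Fact ord_left_subproof n k (i j : 'I_n) : i < j -> i < n + k - 1.
Proof.
by case: n i j => [[]//|n] i j ij; rewrite addSn subn1 /= ltn_addr// (leq_trans ij)// -ltnS.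
Qed.

Definition ord_left n k (i j : 'I_n) (ij : i < j) : 'I_(n + k - 1) :=
  Ordinal (ord_left_subproof k ij).

(* The inclusion of the n x n matrices into the disjoint union over all n:
   equality of two images says that the orders agree and that the matrices
   agree along that equality. *)
Definition in_union n (A : 'M[bool]_n) : {n : nat & 'M[bool]_n} :=
  existT (fun n => 'M[bool]_n) n A.

(* Main.v *)
(* Order-theoretically, the composite replaces the element i of A by a copy of
   B, with s above t iff this holds inside the copy of B, or the images of s
   and t in A (the copy being collapsed to i) are so related and, when s is in
   the copy while t is an element of A numbered below i, s is maximal in B.  The
   axioms reduce to this description because the maximal elements of a composite
   are the maximal elements of A other than i and, if i is maximal in A, the
   maximal elements of B.  Nonemptiness of B enters here: an element of A below
   i stays below some element of B, for instance the last one, which is always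
   maximal. *)

Require Import Defs.
From mathcomp Require Import all_boot all_order all_algebra.
From mathcomp Require Import zify.

Set Implicit Arguments.
Unset Strict Implicit.
Unset Printing Implicit Defensive.

(* Entries are read at natural numbers, with value false out of range, so that
   matrices whose orders are only propositionally equal can be compared. *)
Definition entry n (A : 'M[bool]_n) (s t : nat) : bool :=
  match insub s, insub t with
  | Some s', Some t' => A s' t'
  | _, _ => false
  end.

Lemma entryE n (A : 'M[bool]_n) (s t : 'I_n) (x y : nat) :
  s = x :> nat -> t = y :> nat -> A s t = entry A x y.
Proof. by move=> <- <-; rewrite /entry !valK. Qed.

Lemma entry_ltl n (A : 'M[bool]_n) s t : entry A s t -> s < n.
Proof. by rewrite /entry; case: insubP. Qed.

Lemma entry_ltr n (A : 'M[bool]_n) s t : entry A s t -> t < n.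
Proof. by rewrite /entry; case: insubP => // ? _ _; case: insubP. Qed.

Lemma in_union_ext n p (A : 'M[bool]_n) (B : 'M[bool]_p) : n = p ->
  (forall s t, s < n -> t < n -> entry A s t = entry B s t) ->
  in_union A = in_union B.
Proof.
move=> np; case: _ / np B => B AB; congr in_union.
by apply/matrixP => s t; rewrite !(entryE _ erefl erefl) AB.
Qed.

(** * Posets as relations on the natural numbers *)

(** The first clause joins triangularity to the range bound, so that any related pair yields the
    inequalities that refute impossible cases. *)
Definition poset_rel n (a : rel nat) : Prop :=
  [/\ forall s t, a s t -> t <= s < n,
      forall s, s < n -> a s s
    & forall s t u, a s t -> a t u -> a s u].

Lemma poset_relP n (A : 'M[bool]_n) :
  is_poset_matrix A <-> poset_rel n (entry A).
Proof.
split=> -[tri refl tr]; split.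
- move=> s t st; rewrite (entry_ltl st) andbT leqNgt.
  apply/negP => lt_st; move: (st).
  have [sn tn] := (entry_ltl st, entry_ltr st).
  by rewrite -(@entryE _ A (Ordinal sn) (Ordinal tn) _ _ erefl erefl) tri.
- by move=> s sn; rewrite -(@entryE _ A (Ordinal sn) (Ordinal sn)) ?refl.
- move=> s t u st tu.
  have sn := entry_ltl st.
  have tn := entry_ltr st.
  have un := entry_ltr tu.
  move: st tu.
  rewrite -(@entryE _ A (Ordinal sn) (Ordinal tn) _ _ erefl erefl).
  rewrite -(@entryE _ A (Ordinal tn) (Ordinal un) _ _ erefl erefl).
  rewrite -(@entryE _ A (Ordinal sn) (Ordinal un) _ _ erefl erefl).
  exact: tr.
- move=> s t st; rewrite (entryE _ erefl erefl); apply/negP => /tri.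
  by rewrite leqNgt st.
- by move=> s; rewrite (entryE _ erefl erefl) refl.
- move=> s t u; rewrite !(entryE _ erefl erefl); exact: tr.
Qed.

Definition maximal m (b : rel nat) (j : nat) : bool :=
  all (fun s => b s j ==> (s == j)) (iota 0 m).

Lemma maximalP m b j : poset_rel m b ->
  reflect (forall s, b s j -> s = j) (maximal m b j).
Proof.
move=> [tri _ _]; apply: (iffP allP) => [max s sj|max s _].
  have /andP[_ sm] := tri _ _ sj.
  by apply/eqP/(implyP (max s _)) => //; rewrite mem_iota.
by apply/implyP => /max/eqP.
Qed.

Lemma maximal_last m b : poset_rel m b -> maximal m b m.-1.
Proof. move=> pb; apply/maximalP => // s; case: pb => tri _ _ /tri; lia. Qed.

Lemma poset_maximalE m (B : 'M[bool]_m) (j : 'I_m) :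
  poset_maximal B j = maximal m (entry B) j.
Proof.
apply/forallP/allP => [max s|max s].
  rewrite mem_iota /= => sm; move: (max (Ordinal sm)).
  by rewrite /poset_le (entryE _ erefl erefl).
rewrite /poset_le (entryE _ erefl erefl).
by apply: max; rewrite mem_iota /=.
Qed.

(** * Composition of relations and its maximal elements *)

Definition in_block i m s : bool := i <= s < i + m.

Definition collapse i m s : nat :=
  if s < i then s else if s < i + m then i else s + 1 - m.

Definition rel_comp (a : rel nat) i m (b : rel nat) : rel nat := fun s t =>
  if in_block i m s && in_block i m t then b (s - i) (t - i)
  else a (collapse i m s) (collapse i m t)
       && (in_block i m s && (t < i) ==> maximal m b (s - i)).

Ltac split_regions :=
  rewrite /rel_comp /in_block /collapse;
  repeat (case: leqP => ? /=; try (exfalso; lia)).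

Lemma poset_rel_comp n m a b i : 0 < m -> i < n ->
  poset_rel n a -> poset_rel m b -> poset_rel (n + m - 1) (rel_comp a i m b).
Proof.
move=> m0 ltin pa pb; have [tria refla tra] := pa; have [trib reflb trb] := pb.
split=> [s t|s sn|s t u].
- split_regions; first [by move=> /trib; lia | by move=> /andP[/tria]; lia].
- by split_regions; rewrite ?refla ?reflb //; lia.
split_regions; rewrite ?andbT //; try exact: tra; try exact: trb;
  try by move=> st /andP[tu _]; apply: tra tu.
all: try by move=> /tria ? /tria ?; lia.
(* Here [s] and [t] lie in the copy of [b] and [u] lies before it. Since [t] is maximal, [s = t], so
   the maximality condition passes to [s]. *)
- move=> st /andP[-> maxt].
  by have /(maximalP _ pb)/(_ _ st) -> := maxt.
- by move=> /andP[it _]; apply: tra.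
- by move=> /andP[/tria ? _] /tria ?; lia.
- by move=> /andP[it ->] tu; rewrite (tra _ _ _ it tu).
Qed.

(** Anything above [collapse i m j] in [a] lifts to something above [j]; a lift into the copy of [b]
    has to be maximal there, in case [j] lies before [i]. *)
Lemma maximal_comp n m a b i j : 0 < m -> i < n ->
  poset_rel n a -> poset_rel m b ->
  maximal (n + m - 1) (rel_comp a i m b) j =
  maximal n a (collapse i m j) && (in_block i m j ==> maximal m b (j - i)).
Proof.
move=> m0 ltin pa pb.
have pab := poset_rel_comp m0 ltin pa pb.
have [tria refla tra] := pa; have [trib reflb trb] := pb.
apply/(maximalP _ pab)/andP => [max|[/(maximalP _ pa) maxa maxb] s].
  split.
    apply/(maximalP _ pa) => s sj.
    have [s_lt _] := andP (tria _ _ sj).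
    (* s' is a preimage of s under collapse; for s = i, the last element of B *)
    pose s' := if s < i then s else s + m - 1.
    have sE : collapse i m s' = s.
      by rewrite /s'; case: (ltnP s i) => ?; split_regions; lia.
    case: (boolP (in_block i m s' && in_block i m j)) => [/andP[]|out].
      by rewrite -[LHS]sE; move: s' {sE} => s'; split_regions.
    rewrite -[LHS]sE (max s') // /rel_comp (negPf out) sE sj /=.
    apply/implyP => /andP[s'in _].
    suff -> : s' - i = m.-1 by exact: maximal_last.
    by move: s'in; rewrite /s'; case: (ltnP s i) => ?; split_regions; lia.
  apply/implyP => jin; apply/(maximalP _ pb) => s sj.
  have [_ s_lt] := andP (trib _ _ sj).
  suff : i + s = j by lia.
  apply: max; rewrite /rel_comp jin.
  have -> : in_block i m (i + s) by rewrite /in_block; lia.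
  by rewrite /= addKn.
rewrite /rel_comp.
case: ifP => [/andP[sin jin]|out /andP[/maxa sj _]].
  move: maxb; rewrite jin => /(maximalP _ pb) maxb /maxb.
  by move: sin jin; rewrite /in_block; lia.
(* [collapse] identifies distinct indices only when both lie in the block. *)
by move: out sj; split_regions; lia.
Qed.

(** * Associativity laws for relations *)

(** The critical case has [s] in the copy of [c] and [t] before [i]. Both sides then ask that [j] be
    maximal in [b] and [s] in [c]: the left by two successive conditions, the right by
    [maximal_comp]. *)
Lemma rel_comp_nested n m k a b c i j s t : i < n -> j < m -> 0 < k ->
  poset_rel m b -> poset_rel k c ->
  rel_comp (rel_comp a i m b) (i + j) k c s t =
  rel_comp a i (m + k - 1) (rel_comp b j k c) s t.
Proof.
move=> ltin ltjm k0 pb pc.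
rewrite {3}/rel_comp maximal_comp //.
split_regions; rewrite ?andbT ?andbA //;
  repeat first [by [] | lia | f_equal].
Qed.

(** The copies are disjoint and each maximality condition concerns one factor only; the copy of [b],
    like [i] itself, lies before the copy of [c]. *)
Lemma rel_comp_parallel n m k a b c i j s t : i < j -> j < n -> 0 < m -> 0 < k ->
  rel_comp (rel_comp a i m b) (j + m - 1) k c s t =
  rel_comp (rel_comp a j k c) i m b s t.
Proof.
move=> ltij ltjn m0 k0.
split_regions; rewrite ?andbT //; repeat first [by [] | lia | f_equal].
Qed.

(** * Transfer to matrices *)

Lemma eq_rel_comp a a' i m b b' : a =2 a' -> b =2 b' ->
  rel_comp a i m b =2 rel_comp a' i m b'.
Proof.
move=> aa bb s t; rewrite /rel_comp aa bb /maximal.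
by under eq_all => x do rewrite bb.
Qed.

Lemma eq_poset_rel n a a' : a =2 a' -> poset_rel n a -> poset_rel n a'.
Proof.
move=> aa [tri refl tr]; split=> [s t|s|s t u]; rewrite -!aa.
- exact: tri.
- exact: refl.
- exact: tr.
Qed.

Lemma entry_max_comp_lt n m (A : 'M[bool]_n) (B : 'M[bool]_m) (i : 'I_n) s t :
  is_poset_matrix A -> s < n + m - 1 -> t < n + m - 1 ->
  entry (max_comp A i B) s t = rel_comp (entry A) i m (entry B) s t.
Proof.
move=> pA sn tn; have [tri _ _] := (poset_relP _).1 pA.
(* Where the block matrix has a zero block, [rel_comp] reads an entry of [A] above the diagonal. *)
have F x y : x < y -> entry A x y = false.
  by move=> xy; apply/negP => /tri; lia.
rewrite -(@entryE _ _ (Ordinal sn) (Ordinal tn) _ _ erefl erefl).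
rewrite /max_comp castmxE /block_mx !mxE.
have i_lt := ltn_ord i.
set u := cast_ord _ (Ordinal sn); set v := cast_ord _ (Ordinal tn).
have <- : u = s :> nat by [].
have <- : v = t :> nat by [].
move: u v => u v.
case: splitP => x /= ->; rewrite !mxE; case: splitP => y /= ->; rewrite ?mxE.
- case: splitP => x' /= ->; rewrite !mxE; case: splitP => y' /= ->;
    have := ltn_ord x'; have := ltn_ord y';
    rewrite ?mxE ?(fun_if (fun M : 'rV_i => M _ _)) ?mxE
      ?(@entryE _ _ _ _ _ _ erefl erefl) ?poset_maximalE => ? ? /=; split_regions.
  + by rewrite andbT.
  + by rewrite F.
  + by rewrite addKn; case: maximal; rewrite ?andbT ?andbF.
  + by rewrite !addKn.
- by have := ltn_ord x => ?; split_regions; rewrite F; lia.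
- case: splitP => y' /= ->; have := ltn_ord y';
    rewrite !mxE ?(@entryE _ _ _ _ _ _ erefl erefl) /= => ?; split_regions.
  + by rewrite andbT; congr entry; lia.
  + by rewrite andbT; congr entry; lia.
- rewrite (@entryE _ _ _ _ _ _ erefl erefl) /=; split_regions.
  by rewrite andbT; congr entry; lia.
Qed.

(** Both sides vanish out of range, so the identity holds at all indices and can be used inside a
    further composite through [eq_rel_comp]. *)
Lemma entry_max_comp n m (A : 'M[bool]_n) (B : 'M[bool]_m) (i : 'I_n) :
  0 < m -> is_poset_matrix A -> is_poset_matrix B ->
  entry (max_comp A i B) =2 rel_comp (entry A) i m (entry B).
Proof.
move=> m0 pA pB s t.
have [tri _ _] : poset_rel (n + m - 1) (rel_comp (entry A) i m (entry B)).
  by apply: poset_rel_comp => //; apply/poset_relP.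
have [sn|ns] := ltnP s (n + m - 1); last first.
  have -> : entry (max_comp A i B) s t = false.
    by apply/negP => /entry_ltl; lia.
  by apply/esym/negP => /tri; lia.
have [tn|nt] := ltnP t (n + m - 1); first exact: entry_max_comp_lt.
have -> : entry (max_comp A i B) s t = false.
  by apply/negP => /entry_ltr; lia.
by apply/esym/negP => /tri; lia.
Qed.

Lemma max_comp_poset n m (A : 'M[bool]_n) (B : 'M[bool]_m) (i : 'I_n) :
  0 < m -> is_poset_matrix A -> is_poset_matrix B ->
  is_poset_matrix (max_comp A i B).
Proof.
move=> m0 pA pB; apply/poset_relP.
apply: (@eq_poset_rel _ (rel_comp (entry A) i m (entry B))) => [s t|].
  by rewrite entry_max_comp.
by apply: poset_rel_comp => //; apply/poset_relP.
Qed.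

Lemma unit_pm_poset : is_poset_matrix unit_pm.
Proof.
by split=> [s t|s|s t u]; rewrite !mxE // !ord1.
Qed.

Theorem theorem4 :
  (* (a) *)
  (forall (n m : nat) (A : 'M[bool]_n) (B : 'M[bool]_m) (i : 'I_n),
     0 < n -> 0 < m -> is_poset_matrix A -> is_poset_matrix B ->
     is_poset_matrix (max_comp A i B)) /\
  (* (b) *)
  (forall (n m k : nat) (A : 'M[bool]_n) (B : 'M[bool]_m) (C : 'M[bool]_k)
          (i : 'I_n) (j : 'I_m),
     0 < n -> 0 < m -> 0 < k ->
     is_poset_matrix A -> is_poset_matrix B -> is_poset_matrix C ->
     in_union (max_comp (max_comp A i B) (ord_nested i j) C) =
     in_union (max_comp A i (max_comp B j C))) /\
  (* (c) *)
  (forall (n m k : nat) (A : 'M[bool]_n) (B : 'M[bool]_m) (C : 'M[bool]_k)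
          (i j : 'I_n) (ij : i < j),
     0 < n -> 0 < m -> 0 < k ->
     is_poset_matrix A -> is_poset_matrix B -> is_poset_matrix C ->
     in_union (max_comp (max_comp A i B) (ord_right m ij) C) =
     in_union (max_comp (max_comp A j C) (ord_left k ij) B)) /\
  (* (d) *)
  (forall (n : nat) (A : 'M[bool]_n) (i : 'I_n),
     0 < n -> is_poset_matrix A ->
     in_union (max_comp unit_pm ord0 A) = in_union A /\
     in_union (max_comp A i unit_pm) = in_union A).
Proof.
split; [|split; [|split]].
- by move=> n m A B i _; apply: max_comp_poset.
- move=> n m k A B C i j n0 m0 k0 pA pB pC.
  have pAB := max_comp_poset i m0 pA pB.
  have pBC := max_comp_poset j k0 pB pC.
  have mk0 : 0 < m + k - 1 by lia.
  apply: in_union_ext => [|s t _ _]; first by lia.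
  rewrite (entry_max_comp _ k0 pAB pC) (entry_max_comp _ mk0 pA pBC).
  rewrite (eq_rel_comp _ _ (entry_max_comp _ m0 pA pB) (fun _ _ => erefl)).
  rewrite (eq_rel_comp _ _ (fun _ _ => erefl) (entry_max_comp _ k0 pB pC)).
  by apply: (@rel_comp_nested n) => //; apply/poset_relP.
- move=> n m k A B C i j ij n0 m0 k0 pA pB pC.
  have pAB := max_comp_poset i m0 pA pB.
  have pAC := max_comp_poset j k0 pA pC.
  apply: in_union_ext => [|s t _ _]; first by lia.
  rewrite (entry_max_comp _ k0 pAB pC) (entry_max_comp _ m0 pAC pB).
  rewrite (eq_rel_comp _ _ (entry_max_comp _ m0 pA pB) (fun _ _ => erefl)).
  rewrite (eq_rel_comp _ _ (entry_max_comp _ k0 pA pC) (fun _ _ => erefl)).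
  exact: (@rel_comp_parallel n).
- move=> n A i n0 pA; have [_ refl _] := (poset_relP A).1 pA.
  have pI := unit_pm_poset.
  have [_ reflI _] := (poset_relP unit_pm).1 pI.
  split; apply: in_union_ext => [|s t sn tn]; try by lia.
    (* All indices in range lie in the block. *)
    rewrite entry_max_comp // /rel_comp /in_block /= !subn0.
    by rewrite ifT //; lia.
  (* The single element of the unit is maximal, so its row of [A] is kept. *)
  have max0 : maximal 1 (entry unit_pm) 0 := maximal_last ((poset_relP _).1 pI).
  rewrite entry_max_comp //; split_regions; rewrite ?andbT //;
    try by congr entry; lia.
  + by have [-> -> ->] : [/\ s - i = 0, t - i = 0 & s = t];
      [split; lia | rewrite reflI ?refl //; lia].
  + have -> : s - i = 0 by lia.
    by rewrite max0 andbT; congr entry; lia.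
Qed.
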